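(* Let $1\le d\le n$ be integers, let $v\in S_d$ be a pattern, and let $\mu$ be any log-supermodular probability measure on $\mathcal{P}(n)$. For a family $\mathcal{B}\subseteq\mathcal{P}(n)$ define $$\nu_{\mathcal{B}}:=\mu\left(\{A\in\mathcal{P}(n): B\not\subseteq A \text{ for all } B\in\mathcal{B}\}\right).$$ Then $$\prod_{r=1}^{\binom{n}{d}}\ \prod_{\{B_1,\dots,B_r\}} \nu_{\{B_1,\dots,B_r\}}^{\,f^v_{\{B_1,\dots,B_r\}}(S_n)}\ \leq \sum_{A\subseteq[n],\,|A|<d}\mu(A),$$ where the inner product ranges over all families $\{B_1,\dots,B_r\}$ of $r$ distinct sets in $[n]_d$ (with the convention $0^0=1$).
   Context: $\mathcal{P}(n)$ is the set of all subsets of $[n]=\{1,\dots,n\}$, a distributive lattice under inclusion (meet $\cap$, join $\cup$). A function $\mu:\mathcal{P}(n)\to\mathbb{R}_{\ge0}$ is log-supermodular if $\mu(A)\mu(B)\le\mu(A\cap B)\mu(A\cup B)$ for all $A,B$. $[n]_d$ denotes the set of $d$-element subsets of $[n]$. $S_n$ is the set of permutations of $[n]$. A sequence of $d$ distinct numbers is order-isomorphic to $v\in S_d$ if its entries are in the same relative order as $v_1,\dots,v_d$. For $\pi\in S_n$, $\mathcal{B}_\pi(v)\subseteq[n]_d$ is the set of $B=\{j_1<\dots<j_d\}$ such that $\pi_{j_1}\cdots\pi_{j_d}$ is order-isomorphic to $v$. For distinct $B_1,\dots,B_r\in[n]_d$, $f^v_{\{B_1,\dots,B_r\}}(S_n)$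 is the number of $\pi\in S_n$ with $\mathcal{B}_\pi(v)=\{B_1,\dots,B_r\}$. *)

(* Defs.v *)
From HB Require Import structures.
From mathcomp Require Import all_boot all_order all_fingroup all_algebra.
From mathcomp Require Import reals.
Set Implicit Arguments. Unset Strict Implicit. Unset Printing Implicit Defensive.
Import Order.TTheory GRing.Theory Num.Theory.
Local Open Scope ring_scope.

(* [n] is represented by 'I_n = {0, ..., n-1} throughout, and P(n) by
   {set 'I_n}; only the order of the labels matters below. *)

Section Measures.
Variables (R : realType) (n : nat).
Implicit Types (mu : {set 'I_n} -> R) (BB : {set {set 'I_n}}).

Definition measure_of mu (F : {set {set 'I_n}}) : R := \sum_(A in F) mu A.

Definition probability_measure mu : Prop :=
  (forall A, 0 <= mu A) /\ measure_of mu [set: {set 'I_n}] = 1.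

Definition log_supermodular mu : Prop :=
  forall A B, mu A * mu B <= mu (A :&: B) * mu (A :|: B).

Definition nu mu BB : R :=
  measure_of mu [set A : {set 'I_n} | [forall B in BB, ~~ (B \subset A)]].

End Measures.

Definition dsubsets (n d : nat) : {set {set 'I_n}} :=
  [set B : {set 'I_n} | #|B| == d].

Definition order_isomorphic (s t : seq nat) : bool :=
  (size s == size t) &&
  [forall i : 'I_(size s), forall j : 'I_(size s),
     (nth 0%N s i < nth 0%N s j)%N == (nth 0%N t i < nth 0%N t j)%N].

Definition one_line (d : nat) (v : 'S_d) : seq nat :=
  [seq (v i : nat) | i <- enum 'I_d].

(* The word pi_{j_1} ... pi_{j_d} for B = {j_1 < ... < j_d}; that enum lists B
   in increasing order is enum_set_sorted. *)
Definition subword (n : nat) (p : 'S_n) (B : {set 'I_n}) : seq nat :=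
  [seq (p j : nat) | j <- enum B].

Lemma enum_set_sorted (n : nat) (B : {set 'I_n}) :
  sorted ltn [seq val j | j <- enum B].
Proof.
rewrite {1}/enum_mem -enumT sorted_map.
apply: sorted_filter; first by move=> x y z; apply: ltn_trans.
by rewrite -sorted_map val_enum_ord iota_ltn_sorted.
Qed.

Definition occurrences (n d : nat) (v : 'S_d) (p : 'S_n) : {set {set 'I_n}} :=
  [set B in dsubsets n d | order_isomorphic (subword p B) (one_line v)].

(* f^v_{BB}(S_n). *)
Definition occurrence_count (n d : nat) (v : 'S_d) (BB : {set {set 'I_n}}) : nat :=
  #|[set p : 'S_n | occurrences v p == BB]|.

(* Main.v *)
Require Import Defs.
From HB Require Import structures.
From mathcomp Require Import all_boot all_order all_fingroup all_algebra.
From mathcomp Require Import reals.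
From mathcomp Require Import primitive_action alt lra.
Set Implicit Arguments. Unset Strict Implicit. Unset Printing Implicit Defensive.
Import Order.TTheory GRing.Theory Num.Theory.
Local Open Scope ring_scope.

(** The left-hand side is the product of [nu mu (occurrences v p)] over all
    permutations [p], because the missing factor of the empty family is 1.
    Containing no member of a family is a decreasing event, and avoiding a
    union of families is the conjunction of the avoidances, so the FKG
    inequality gives [nu mu BB * nu mu CC <= nu mu (BB :|: CC)].  As the
    symmetric group is d-transitive, every d-subset is an occurrence of [v] in
    some permutation, so the union of all these families is [dsubsets n d], and
    a set contains no d-subset exactly when it has fewer than d elements.

    The FKG inequality is a case of the four functions theorem of Ahlswede and
    Daykin, which goes by induction on the ground set: the subsets of [x |: S]
    form the product of those of [S] with the two-element lattice. *)

Section Adjoin.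
Variables (T : finType) (x : T).
Implicit Types (i j : bool) (A B S : {set T}).

Definition adjoin i A : {set T} := if i then x |: A else A.

Lemma adjoinU i j A B : adjoin i A :|: adjoin j B = adjoin (i || j) (A :|: B).
Proof.
apply/setP => y; case: i; case: j; rewrite !inE //.
all: by case: (y == x); rewrite ?orbT.
Qed.

Lemma adjoinI i j A B : x \notin A -> x \notin B ->
  adjoin i A :&: adjoin j B = adjoin (i && j) (A :&: B).
Proof.
move=> /negPf xA /negPf xB; apply/setP => y.
by case: i; case: j; rewrite !inE //; case: eqP => //= ->; rewrite xA xB.
Qed.

Lemma in_adjoin i A : x \notin A -> (x \in adjoin i A) = i.
Proof. by case: i => /negPf xA; rewrite /adjoin ?setU11 ?xA. Qed.

Lemma setD1_id A : x \notin A -> A :\ x = A.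
Proof. by move=> xA; apply/setDidPl; rewrite disjoint_sym disjoints1. Qed.

Lemma adjoinK i A : x \notin A -> adjoin i A :\ x = A.
Proof. by case: i; [apply: setU1K | apply: setD1_id]. Qed.

Lemma adjoin_setD1 A : adjoin (x \in A) (A :\ x) = A.
Proof. by rewrite /adjoin; case: ifPn; [apply: setD1K | apply: setD1_id]. Qed.

Lemma adjoin_subset i A S : (adjoin i A \subset x |: S) = (A \subset x |: S).
Proof. by case: i; rewrite // subUset sub1set setU11. Qed.

Lemma big_powerset_setU1 (R : Type) (idx : R) (op : Monoid.com_law idx) S
    (F : {set T} -> R) :
  x \notin S ->
  \big[op/idx]_(A in powerset (x |: S)) F A =
  \big[op/idx]_(A in powerset S) \big[op/idx]_i F (adjoin i A).
Proof.
move=> xS; rewrite pair_big /= (reindex_onto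
  (fun p => adjoin p.2 p.1) (fun A => (A :\ x, x \in A))) /=; last first.
  by move=> A _; apply: adjoin_setD1.
apply: eq_bigl => -[A i]; rewrite andbT !powersetE adjoin_subset.
rewrite -[in RHS](setU1K xS) subsetD1; apply: andb_id2l => _.
apply/eqP/idP => [[<- _] | xA]; first by rewrite setD11.
by rewrite adjoinK // in_adjoin.
Qed.

End Adjoin.

Section FourFunctions.
Variable R : realDomainType.

Lemma lerM_imp_lerD (p q u w : R) : 0 <= p -> 0 <= w ->
  p <= u -> q <= u -> p * q <= u * w -> p + q <= u + w.
Proof.
move=> p_ge0 w_ge0 pu qu pquw.
have [u0 | u_neq0] := eqVneq u 0; first by lra.
have u_gt0 : 0 < u by rewrite lt_def u_neq0 (le_trans p_ge0).
rewrite -(ler_pM2l u_gt0).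
have : 0 <= (u - p) * (u - q) by rewrite mulr_ge0 // subr_ge0.
by lra.
Qed.

Lemma four_functions_bool (a b c e : bool -> R) :
  (forall i, 0 <= a i) -> (forall i, 0 <= b i) ->
  (forall i, 0 <= c i) -> (forall i, 0 <= e i) ->
  (forall i j, a i * b j <= c (i && j) * e (i || j)) ->
  (\sum_i a i) * (\sum_i b i) <= (\sum_i c i) * (\sum_i e i).
Proof.
move=> a_ge0 b_ge0 c_ge0 e_ge0 abce; rewrite !big_bool /=.
have /= [abTT abTF] := (abce true true, abce true false).
have /= [abFT abFF] := (abce false true, abce false false).
suff mixed : a true * b false + a false * b true <=
    c false * e true + c true * e false by lra.
apply: lerM_imp_lerD; rewrite ?mulr_ge0 //.
have := ler_pM _ _ abTT abFF; rewrite !mulr_ge0 // => /(_ isT isT).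
by lra.
Qed.

Variable T : finType.
Implicit Types (A B S : {set T}) (mu f g : {set T} -> R).

Lemma four_functions_powerset S (a b c e : {set T} -> R) :
  (forall A, 0 <= a A) -> (forall A, 0 <= b A) ->
  (forall A, 0 <= c A) -> (forall A, 0 <= e A) ->
  {in powerset S &, forall A B, a A * b B <= c (A :&: B) * e (A :|: B)} ->
  (\sum_(A in powerset S) a A) * (\sum_(A in powerset S) b A) <=
  (\sum_(A in powerset S) c A) * (\sum_(A in powerset S) e A).
Proof.
have [m] := ubnP #|S|; elim: m => // m IHm in S a b c e *.
move=> Sm a_ge0 b_ge0 c_ge0 e_ge0 abce.
have [S0 | [x xS]] := set_0Vmem S.
  move: abce; rewrite {}S0 powerset0 !big_set1 => abce.
  by have := abce set0 set0; rewrite setI0 setU0 => -> //; rewrite inE.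
have xS' : x \notin S :\ x by rewrite setD11.
rewrite -(setD1K xS) !big_powerset_setU1 //.
apply: IHm => [|A|A|A|A|A B]; rewrite ?sumr_ge0 //.
  by rewrite (cardsD1 x) xS in Sm.
rewrite !powersetE !subsetD1 => /andP[AS xA] /andP[BS xB].
apply: four_functions_bool => // i j; rewrite -adjoinI // -adjoinU.
by apply: abce; rewrite powersetE -(setD1K xS) adjoin_subset setD1K.
Qed.

Lemma four_functions (a b c e : {set T} -> R) :
  (forall A, 0 <= a A) -> (forall A, 0 <= b A) ->
  (forall A, 0 <= c A) -> (forall A, 0 <= e A) ->
  (forall A B, a A * b B <= c (A :&: B) * e (A :|: B)) ->
  (\sum_A a A) * (\sum_A b A) <= (\sum_A c A) * (\sum_A e A).
Proof.
move=> a_ge0 b_ge0 c_ge0 e_ge0 abce.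
have := four_functions_powerset a_ge0 b_ge0 c_ge0 e_ge0 (S := setT) (in2W abce).
by rewrite powersetT !big_set.
Qed.

Lemma fkg_antitone mu f g :
  (forall A, 0 <= mu A) ->
  (forall A B, mu A * mu B <= mu (A :&: B) * mu (A :|: B)) ->
  (forall A, 0 <= f A) -> (forall A, 0 <= g A) ->
  {homo f : A B / A \subset B >-> B <= A} ->
  {homo g : A B / A \subset B >-> B <= A} ->
  (\sum_A mu A * f A) * (\sum_A mu A * g A) <=
  (\sum_A mu A * (f A * g A)) * (\sum_A mu A).
Proof.
move=> mu_ge0 mu_lsm f_ge0 g_ge0 f_anti g_anti.
apply: four_functions => [A|A|A|//|A B]; rewrite ?mulr_ge0 //.
rewrite mulrACA [leRHS]mulrAC ler_pM ?mulr_ge0 //.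
by rewrite ler_pM ?f_anti ?g_anti ?subsetIl ?subsetIr.
Qed.

End FourFunctions.

Section Avoids.
Variable T : finType.
Implicit Types (A B : {set T}) (BB CC : {set {set T}}).

Definition avoids BB A : bool := [forall B in BB, ~~ (B \subset A)].

Lemma avoids_set0 A : avoids set0 A.
Proof. by apply/forall_inP => B; rewrite inE. Qed.

Lemma avoidsU BB CC A : avoids (BB :|: CC) A = avoids BB A && avoids CC A.
Proof.
apply/forall_inP/andP => [avBC | [/forall_inP avB /forall_inP avC] D].
  by split; apply/forall_inP => D DBC; apply: avBC; rewrite inE DBC ?orbT.
by rewrite inE => /orP[/avB | /avC].
Qed.

Lemma avoids_subset BB A B : A \subset B -> avoids BB B -> avoids BB A.
Proof.
move=> sAB /forall_inP avB; apply/forall_inP => C /avB.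
by apply: contra => sCA; apply: subset_trans sCA sAB.
Qed.

Lemma avoids_card (d : nat) A :
  avoids [set B : {set T} | #|B| == d] A = (#|A| < d)%N.
Proof.
apply/forall_inP/idP => [avA | ltAd B]; last first.
  rewrite inE => /eqP cardB; apply: contraL ltAd => /subset_leq_card.
  by rewrite cardB -leqNgt.
rewrite ltnNge; apply/negP => dA.
have /card_gt0P[B] : (0 < #|[set B : {set T} | B \subset A & #|B| == d]|)%N.
  by rewrite cards_draws bin_gt0.
rewrite inE => /andP[sBA cardB].
by move: (avA B); rewrite inE cardB sBA => /(_ isT).
Qed.

End Avoids.

Section Nu.
Variables (R : realType) (n : nat) (mu : {set 'I_n} -> R).
Implicit Types BB CC : {set {set 'I_n}}.

Lemma nu_avoids BB : nu mu BB = \sum_(A | avoids BB A) mu A.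
Proof. by apply: eq_bigl => A; rewrite inE. Qed.

Lemma nu_dsubsets (d : nat) :
  nu mu (dsubsets n d) = \sum_(A : {set 'I_n} | (#|A| < d)%N) mu A.
Proof. by rewrite nu_avoids; apply: eq_bigl => A; rewrite avoids_card. Qed.

Hypothesis mu_prob : probability_measure mu.

Lemma sum_probability_measure : \sum_A mu A = 1.
Proof. by have [_ <-] := mu_prob; rewrite /measure_of big_set. Qed.

Lemma nu_ge0 BB : 0 <= nu mu BB.
Proof. by apply: sumr_ge0 => A _; case: mu_prob. Qed.

Lemma nu_set0 : nu mu set0 = 1.
Proof.
rewrite nu_avoids -sum_probability_measure.
by apply: eq_bigl => A; rewrite avoids_set0.
Qed.

Hypothesis mu_lsm : log_supermodular mu.

Lemma nuM_le_nuU BB CC : nu mu BB * nu mu CC <= nu mu (BB :|: CC).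
Proof.
have nu_indicator DD : nu mu DD = \sum_A mu A * (avoids DD A)%:R.
  rewrite nu_avoids big_mkcond; apply: eq_bigr => A _.
  by rewrite mulr_natr mulrb.
have indicator_antitone DD :
    {homo (fun A => (avoids DD A)%:R : R) : A B / A \subset B >-> B <= A}.
  move=> A B sAB; rewrite ler_nat; case avB: (avoids DD B) => //.
  by rewrite (avoids_subset sAB avB).
have -> : nu mu (BB :|: CC) =
    \sum_A mu A * ((avoids BB A)%:R * (avoids CC A)%:R).
  rewrite nu_indicator.
  by apply: eq_bigr => A _; rewrite avoidsU -mulnb natrM.
rewrite !nu_indicator -[leRHS]mulr1 -[X in _ <= _ * X]sum_probability_measure.
by apply: fkg_antitone => //; case: mu_prob.
Qed.

Lemma prod_nu_le_nu_bigcup (I : Type) (r : seq I) (F : I -> {set {set 'I_n}}) :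
  \prod_(i <- r) nu mu (F i) <= nu mu (\bigcup_(i <- r) F i).
Proof.
elim: r => [|i r IHr]; first by rewrite !big_nil nu_set0.
by rewrite !big_cons (le_trans _ (nuM_le_nuU _ _)) // ler_wpM2l ?nu_ge0.
Qed.

End Nu.

Lemma perm_map_uniq (T : finType) (s t : seq T) :
  uniq s -> uniq t -> size s = size t -> exists p : {perm T}, map p s = t.
Proof.
move=> s_uniq t_uniq eq_st.
have Sym_trans_s : [transitive^(size s) 'Sym_T, on setT | 'P].
  apply: ntransitive_weak (Sym_trans T).
  by rewrite -(card_uniqP s_uniq) max_card.
have in_dtuple (w : (size s).-tuple T) : uniq w -> w \in (size s).-dtuple(setT).
  by move=> w_uniq; rewrite inE w_uniq; apply/subsetP.
have /eqP t_size := esym eq_st.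
have [p _ /(congr1 val)/= ->] := atransP2 Sym_trans_s
  (in_dtuple (in_tuple s) s_uniq) (in_dtuple (Tuple t_size) t_uniq).
by exists p.
Qed.

Lemma order_isomorphic_refl (s : seq nat) : order_isomorphic s s.
Proof. by rewrite /order_isomorphic eqxx; apply/'forall_forallP => i j /=. Qed.

Section Occurrences.
Variables (n d : nat) (v : 'S_d).

Lemma exists_subword_one_line (B : {set 'I_n}) :
  #|B| = d -> exists p : 'S_n, subword p B = one_line v.
Proof.
move=> cardB.
have led : (d <= n)%N by rewrite -cardB -[leqRHS]card_ord max_card.
have [||| p pB] := @perm_map_uniq _ (enum B)
    [seq widen_ord led (v i) | i <- enum 'I_d].
- exact: enum_uniq.
- rewrite map_inj_uniq ?enum_uniq // => i j.
  by move/(congr1 val) => /= /val_inj /perm_inj.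
- by rewrite size_map size_enum_ord -cardE.
exists p; rewrite /subword /one_line.
by rewrite (map_comp val p) pB -map_comp.
Qed.

Lemma occurrences_subset (p : 'S_n) : occurrences v p \subset dsubsets n d.
Proof. by apply/subsetP => B; rewrite inE => /andP[]. Qed.

Lemma bigcup_occurrences : \bigcup_(p : 'S_n) occurrences v p = dsubsets n d.
Proof.
apply/eqP; rewrite eqEsubset; apply/andP; split.
  by apply/bigcupsP => p _; apply: occurrences_subset.
apply/subsetP => B Bd; have := Bd; rewrite inE => /eqP.
move=> /exists_subword_one_line[p pB]; apply/bigcupP; exists p => //.
by rewrite inE Bd pB order_isomorphic_refl.
Qed.

End Occurrences.

Lemma big_nat_fibers (R : Type) (idx : R) (op : Monoid.com_law idx)
    (I : finType) (P : pred I) (h : I -> nat) (F : I -> R) (m k : nat) :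
  \big[op/idx]_(m <= r < k) \big[op/idx]_(i | P i && (h i == r)) F i =
  \big[op/idx]_(i | P i && (m <= h i < k)%N) F i.
Proof.
rewrite (exchange_big_dep P) => [|r i _ /andP[]//]; rewrite big_mkcondr.
apply: eq_bigr => i Pi; rewrite -(big_nat1_eq op (fun=> F i)).
by apply: eq_bigl => r; rewrite Pi eq_sym.
Qed.

Lemma prod_card_fibers (R : comPzSemiRingType) (I J : finType) (f : I -> J)
    (Q : pred J) (g : J -> R) :
  (forall i, Q (f i)) ->
  \prod_(j | Q j) g j ^+ #|[set i | f i == j]| = \prod_i g (f i).
Proof.
move=> Qf; rewrite [RHS](partition_big f Q) //=; apply: eq_bigr => j _.
rewrite -prodr_const; apply: eq_big => [i | i]; first by rewrite inE.
by rewrite inE => /eqP ->.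
Qed.

Lemma prod_occurrence_count (R : comPzSemiRingType) (n d : nat) (v : 'S_d)
    (g : {set {set 'I_n}} -> R) :
  g set0 = 1 ->
  \prod_(1 <= r < 'C(n, d).+1)
    \prod_(BB : {set {set 'I_n}} | (BB \subset dsubsets n d) && (#|BB| == r))
      g BB ^+ occurrence_count v BB
  = \prod_(p : 'S_n) g (occurrences v p).
Proof.
move=> g0; rewrite big_nat_fibers.
transitivity (\prod_(BB : {set {set 'I_n}} | BB \subset dsubsets n d)
                g BB ^+ occurrence_count v BB).
  rewrite big_mkcondr; apply: eq_bigr => BB /subset_leq_card.
  rewrite card_draws card_ord ltnS => ->; rewrite andbT card_gt0.
  by case: eqP => // ->; rewrite g0 expr1n.
by apply: prod_card_fibers; apply: occurrences_subset.
Qed.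

Theorem theorem2 (R : realType) (n d : nat) (hd : (1 <= d)%N) (hdn : (d <= n)%N)
  (v : 'S_d) (mu : {set 'I_n} -> R)
  (hprob : probability_measure mu) (hlsm : log_supermodular mu) :
  \prod_(1 <= r < 'C(n, d).+1)
    \prod_(BB : {set {set 'I_n}} | (BB \subset dsubsets n d) && (#|BB| == r))
      nu mu BB ^+ occurrence_count v BB
  <= \sum_(A : {set 'I_n} | (#|A| < d)%N) mu A.
Proof.
rewrite (prod_occurrence_count v (nu_set0 hprob)).
rewrite -nu_dsubsets -(bigcup_occurrences n v).
exact: prod_nu_le_nu_bigcup.
Qed.
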